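(* Let $G$ be a connected graph (finite, simple, with at least two vertices). Then $G$ is completeness-resolvable if and only if $G$ is isomorphic to a graph in $\mathcal P\cup\mathcal K\cup\mathcal B\cup\mathcal C$, where $\mathcal P$ is the set of all paths, $\mathcal K$ is the set of graphs having a universal vertex, $\mathcal B=\bigcup_{k\ge 2}\mathcal B_k$ and $\mathcal C=\bigcup_{k\ge 2}\mathcal C_k$.
   Context: All graphs are finite and simple with at least two vertices. A vertex is universal if it is adjacent to every other vertex. $d(u,v)$ is the length of a shortest path. For a positive integer $m$ let $[m]=\{1,\dots,m\}$, and $[m]^k$ is the set of vectors $x=(x_{(1)},\dots,x_{(k)})$ with all $x_{(i)}\in[m]$. Completeness-resolvable: for a connected graph $G$ and a nonempty proper subset $W=\{w_1,\dots,w_{|W|}\}\subset V(G)$ let $m(W)=\max\{d(w,u): w\in W,\ u\in V(G)\setminus W\}$. $W$ is a completeness-resolving set if $\Psi_W:V(G)\setminus W\to[m(W)]^{|W|}$, $u\mapsto(d(w_1,u),\dots,d(w_{|W|},u))$, is a bijection. $G$ is completeness-resolvable if it has a completeness-resolving set. Edge coverings: for a graph $F$ and $S\subseteq V(F)$, an $S$-covering in $F$ is a set $E\subseteq E(F)$ such that every vertex of $S$ is incident to at least one edge of $E$. $\mathcal E(F,S)$ is the set of all $S$-coverings in $F$. The operation $\circ$: for a graph $H_1$ with vertex set $[k]$ and a graph $H_2$ with vertex set $[m]^k$, $H_1\circ H_2$ is the graph on the disjoint union $[k]\sqcup[m]^k$ with edge set $E(H_1)\cup E(H_2)\cup\{\{i,x\}: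 i\in[k],\ x\in[m]^k,\ x_{(i)}=1\}$. For a set $E$ of 2-subsets of $[m]^k$, $span(E)$ is the graph with vertex set $[m]^k$ and edge set $E$. $\overline K_{[k]}$ is the edgeless graph on $[k]$. For $I\subseteq[k]$, $J\subseteq[m]$, $[m]^k_I(J)=\{x\in[m]^k: x_{(i)}\in J\ \forall i\in I\}$; singletons $\{i\},\{j\}$ are written $i,j$. $\mathcal B_k$ ($k\ge2$): for $i\in[k]$ let $B^k_i$ be the complete bipartite graph with parts $[2]^k_i(1)$ and $[2]^k_i(2)$. For a graph $H_1$ on $[k]$ let $H_1(i)$ be the union of $\{i\}$ and the set of neighbours of $i$ in $H_1$. Then $$\mathcal B_k=\Big\{H_1\circ span\Big(\bigcup_{i\in[k]}E_i\Big): H_1 \text{ a graph on } [k],\ E_i\in\mathcal E(B^k_i,[2]^k_{H_1(i)}(2))\ \text{for each } i\in[k]\Big\}.$$ $\mathcal C_k$ ($k\ge2$): for $i\in[k]$ let $C^k_i$ be the bipartite graph with parts $[3]^k_i(1)$ and $[3]^k_i(2)$, in which $x\in[3]^k_i(1)$ and $y\in[3]^k_i(2)$ are adjacent iff $|x_{(t)}-y_{(t)}|\le1$ for all $t\in[k]\setminus\{i\}$; let $D^k_i$ be the bipartite graph with parts $[3]^k_i(2)$ and $[3]^k_i(3)$, in which $x\in[3]^k_i(2)$ and $y\in[3]^k_i(3)$ are adjacent iff $|x_{(t)}-y_{(t)}|\le1$ for all $t\in[k]\setminus\{i\}$. Let $S^k_i=[3]^k_{[k]}(\{2,3\})\cap[3]^k_i(3)$.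 Then $$\mathcal C_k=\Big\{\overline K_{[k]}\circ span\Big(\bigcup_{i\in[k]}(E_i\cup F_i)\Big): E_i\in\mathcal E(C^k_i,[3]^k_i(2)),\ F_i\in\mathcal E(D^k_i,S^k_i)\ \text{for each } i\in[k]\Big\}.$$ *)

(* Defs.v *)
From mathcomp Require Import all_boot.

Set Implicit Arguments.
Unset Strict Implicit.
Unset Printing Implicit Defensive.

Record sgraph (V : finType) := SGraph {
  adj :> rel V;
  adj_sym : symmetric adj;
  adj_irrefl : irreflexive adj }.

Definition graph_class := forall V : finType, sgraph V -> Prop.

Definition isomorphic (V W : finType) (G : sgraph V) (H : sgraph W) : Prop :=
  exists2 f : V -> W, bijective f & forall x y, H (f x) (f y) = G x y.

Definition connected (V : finType) (G : sgraph V) : Prop :=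
  forall u v, connect G u v.

Definition universal (V : finType) (G : sgraph V) (u : V) : Prop :=
  forall v, v != u -> G u v.

Definition edges (V : finType) (F : sgraph V) : {set {set V}} :=
  [set [set p.1; p.2] | p : V * V & F p.1 p.2].

Definition coverings (V : finType) (F : sgraph V) (S : {set V}) :
    {set {set {set V}}} :=
  [set E : {set {set V}} | (E \subset edges F) &&
    [forall x in S, [exists p in E, x \in p]]].

Definition has_path (V : finType) (G : sgraph V) (u v : V) (n : nat) : bool :=
  [exists p : n.-tuple V, [&& path G u p, uniq (u :: p) & last u p == v]].

(* A path with distinct vertices has length < #|V|, so this is the length of a
   shortest path from u to v; it is #|V| when there is no such path. *)
Definition dist (V : finType) (G : sgraph V) (u v : V) : nat :=
  find (has_path G u v) (iota 0 #|V|).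

(* The set [m]^k, with [m] = {1, ..., m} represented by 'I_m: the ordinal j
   stands for j.+1. Coordinates must be read through crd. *)
Definition vec (m k : nat) : finType := {ffun 'I_k -> 'I_m}.

Definition crd (m k : nat) (x : vec m k) (i : 'I_k) : nat := (x i).+1.

(* [m]^k_I(J) *)
Definition subcube (m k : nat) (I : {set 'I_k}) (J : seq nat) : {set vec m k} :=
  [set x | [forall i in I, crd x i \in J]].
Arguments subcube m [k] I J.

Definition max_dist (V : finType) (G : sgraph V) (W : {set V}) : nat :=
  \max_(w in W) \max_(u | u \notin W) dist G w u.

(* The vertices w_1, ..., w_|W| of W are enumerated by enum_val; the equation
   on coordinates determines Psi. *)
Definition completeness_resolving (V : finType) (G : sgraph V) (W : {set V}) :
    Prop :=
  exists Psi : {u : V | u \notin W} -> vec (max_dist G W) #|W|,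
    (forall u (i : 'I_#|W|), crd (Psi u) i = dist G (enum_val i) (val u)) /\
    bijective Psi.

Definition completeness_resolvable (V : finType) (G : sgraph V) : Prop :=
  exists W : {set V},
    [/\ W != set0, W \proper [set: V] & completeness_resolving G W].

Section Span.
Variables (V : finType) (E : {set {set V}}).

Definition span_adj : rel V := fun x y => (x != y) && ([set x; y] \in E).

Lemma span_adj_sym : symmetric span_adj.
Proof. by move=> x y; rewrite /span_adj eq_sym setUC. Qed.

Lemma span_adj_irrefl : irreflexive span_adj.
Proof. by move=> x; rewrite /span_adj eqxx. Qed.

Definition span := SGraph span_adj_sym span_adj_irrefl.
End Span.

Section Edgeless.
Variable V : finType.

Definition edgeless_adj : rel V := fun _ _ => false.

Lemma edgeless_adj_sym : symmetric edgeless_adj.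
Proof. by []. Qed.

Lemma edgeless_adj_irrefl : irreflexive edgeless_adj.
Proof. by []. Qed.

Definition edgeless := SGraph edgeless_adj_sym edgeless_adj_irrefl.
End Edgeless.
Arguments edgeless V : clear implicits.

(* The bipartite graph with parts A and B in which x in A and y in B are
   adjacent iff R x y. The clause x != y only makes the definition total: it is
   redundant when A and B are disjoint. Elements of V outside A and B are kept
   as isolated vertices, which affects neither the edges nor the coverings of
   subsets of A :|: B. *)
Section Bipartite.
Variables (V : finType) (A B : {set V}) (R : rel V).

Definition bipartite_adj : rel V := fun x y =>
  (x != y) && ([&& x \in A, y \in B & R x y] || [&& y \in A, x \in B & R y x]).

Lemma bipartite_adj_sym : symmetric bipartite_adj.
Proof. by move=> x y; rewrite /bipartite_adj eq_sym orbC. Qed.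

Lemma bipartite_adj_irrefl : irreflexive bipartite_adj.
Proof. by move=> x; rewrite /bipartite_adj eqxx. Qed.

Definition bipartite := SGraph bipartite_adj_sym bipartite_adj_irrefl.
End Bipartite.

Section Circ.
Variables (m k : nat) (H1 : sgraph 'I_k) (H2 : sgraph (vec m k)).

Definition circ_adj : rel ('I_k + vec m k) := fun a b =>
  match a, b with
  | inl i, inl j => H1 i j
  | inr x, inr y => H2 x y
  | inl i, inr x | inr x, inl i => crd x i == 1
  end.

Lemma circ_adj_sym : symmetric circ_adj.
Proof. by move=> [i|x] [j|y] //=; apply: adj_sym. Qed.

Lemma circ_adj_irrefl : irreflexive circ_adj.
Proof. by move=> [i|x] /=; apply: adj_irrefl. Qed.

Definition circ : sgraph ('I_k + vec m k)%type :=
  SGraph circ_adj_sym circ_adj_irrefl.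
End Circ.

Section PathGraph.
Variable n : nat.

Definition path_adj : rel 'I_n := fun i j => (i.+1 == j) || (j.+1 == i).

Lemma path_adj_sym : symmetric path_adj.
Proof. by move=> i j; rewrite /path_adj orbC. Qed.

Lemma path_adj_irrefl : irreflexive path_adj.
Proof. by move=> i; rewrite /path_adj orbb gtn_eqF. Qed.

Definition path_graph := SGraph path_adj_sym path_adj_irrefl.
End PathGraph.

Inductive class_P : graph_class :=
  InP (n : nat) of 2 <= n : class_P (path_graph n).

Definition class_K : graph_class := fun V G =>
  2 <= #|V| /\ exists u : V, universal G u.

Definition closed_nbh (k : nat) (H1 : sgraph 'I_k) (i : 'I_k) : {set 'I_k} :=
  [set j | (j == i) || H1 i j].

Definition graph_B (k : nat) (i : 'I_k) : sgraph (vec 2 k) :=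
  bipartite (subcube 2 [set i] [:: 1]) (subcube 2 [set i] [:: 2])
    (fun _ _ => true).

Inductive class_B (k : nat) : graph_class :=
  InB (H1 : sgraph 'I_k) (E : 'I_k -> {set {set vec 2 k}}) of
    (forall i, E i \in coverings (graph_B i)
                         (subcube 2 (closed_nbh H1 i) [:: 2]))
  : class_B k (circ H1 (span (\bigcup_(i < k) E i))).

Definition near_off (k : nat) (i : 'I_k) : rel (vec 3 k) := fun x y =>
  [forall (t | t != i),
    (crd x t <= (crd y t).+1) && (crd y t <= (crd x t).+1)].

Definition graph_C (k : nat) (i : 'I_k) : sgraph (vec 3 k) :=
  bipartite (subcube 3 [set i] [:: 1]) (subcube 3 [set i] [:: 2]) (near_off i).

Definition graph_D (k : nat) (i : 'I_k) : sgraph (vec 3 k) :=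
  bipartite (subcube 3 [set i] [:: 2]) (subcube 3 [set i] [:: 3]) (near_off i).

Definition set_S (k : nat) (i : 'I_k) : {set vec 3 k} :=
  subcube 3 [set: 'I_k] [:: 2; 3] :&: subcube 3 [set i] [:: 3].

Inductive class_C (k : nat) : graph_class :=
  InC (E F : 'I_k -> {set {set vec 3 k}}) of
    (forall i, E i \in coverings (graph_C i) (subcube 3 [set i] [:: 2])) &
    (forall i, F i \in coverings (graph_D i) (set_S i))
  : class_C k (circ (edgeless 'I_k) (span (\bigcup_(i < k) (E i :|: F i)))).

(* Main.v *)
Require Import Defs.
From mathcomp Require Import all_boot zify.

Set Implicit Arguments.
Unset Strict Implicit.
Unset Printing Implicit Defensive.

(* A resolving set W with k elements identifies V(G) with W plus [m]^k so that
   the i-th coordinate of x is d(i, x); hence m = 1 forces a universal vertex,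
   and k = 1 forces a path.  For distinct i, j in W, the vector (1, ..., 1) is
   adjacent to both, so d(i, j) <= 2, while a vector with entry m at i and 1 at
   j gives m <= d(i, j) + 1: thus m <= 3, and m = 3 makes W independent.  The
   covering conditions say exactly that a vertex at distance n + 1 from i has a
   neighbour at distance n.  Conversely, a function on the vertices that
   vanishes only at u, grows by at most 1 along edges and drops by 1 along some
   edge wherever it is positive is the distance from u. *)

(** * Distances: walks, shortest paths and a characterization by local conditions *)

Section Distance.
Variables (V : finType) (G : sgraph V).

Lemma has_path_uniq u p : path G u p -> uniq (u :: p) ->
  has_path G u (last u p) (size p).
Proof.
by move=> Gp Up; apply/existsP; exists (in_tuple p); rewrite Gp Up eqxx.
Qed.

(** Shortening the walk to a duplicate-free path gives a length that the search in [dist] must meet.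
    The bound by [#|V|] certifies that [dist] is not its default value. *)
Lemma path_dist u p : path G u p ->
  dist G u (last u p) <= size p /\ dist G u (last u p) < #|V|.
Proof.
move=> Gp; case/shortenP: Gp => q Gq Uq sub_qp.
have le_qp: size q <= size p.
  by case/andP: Uq => _ Uq; apply: uniq_leq_size Uq sub_qp.
have lt_qV: size q < #|V|.
  by have := max_card (mem (u :: q)); rewrite (card_uniqP Uq).
suff le_dq: dist G u (last u q) <= size q.
  by split; [exact: leq_trans le_qp | exact: leq_ltn_trans lt_qV].
rewrite leqNgt; apply/negP => lt_qd.
have := before_find 0 lt_qd.
by rewrite nth_iota // add0n has_path_uniq.
Qed.

Lemma dist_path u v : dist G u v < #|V| ->
  exists p, [/\ path G u p, last u p = v & size p = dist G u v].
Proof.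
move=> lt_dV; have: has (has_path G u v) (iota 0 #|V|).
  by rewrite has_find size_iota.
move/(nth_find 0); rewrite -/(dist G u v) nth_iota // add0n.
case/existsP=> p /and3P[Gp _ /eqP last_p].
by exists p; rewrite size_tuple.
Qed.

Lemma dist0 u v : (dist G u v == 0) = (u == v).
Proof.
have V_gt0: 0 < #|V| by apply/card_gt0P; exists u.
apply/eqP/eqP => [d0|<-]; last first.
  by have [] := @path_dist u [::] isT; rewrite leqn0 => /eqP.
have [|p [_ + +]] := @dist_path u v; first by rewrite d0.
by rewrite d0; case: p.
Qed.

Lemma dist_adj u v : G u v -> dist G u v = 1.
Proof.
move=> Guv; have [] := @path_dist u [:: v]; first by rewrite /= Guv.
move=> /= le1 _; have: dist G u v != 0.
  by rewrite dist0; apply: contraTneq Guv => ->; rewrite adj_irrefl.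
lia.
Qed.

(** Descending repeatedly from [v] builds a walk of length [d v] from [u], so [v] is reachable and
    [dist] is at most [d]. Along a shortest path [d] starts at 0 and grows by at most 1 per edge,
    which gives the converse inequality. *)
Lemma dist_unique u (d : V -> nat) :
    (forall v, (d v == 0) = (u == v)) ->
    (forall v w, G v w -> d w <= (d v).+1) ->
    (forall v n, d v = n.+1 -> exists2 w, G w v & d w = n) ->
  forall v, dist G u v = d v.
Proof.
move=> d0 d_edge d_step v.
have [p [Gp lp sz_p]]: exists p, [/\ path G u p, last u p = v & size p = d v].
  move dv: (d v) => n; elim: n v dv => [|n IHn] v dv.
    by exists [::]; split=> //=; apply/eqP; rewrite -d0 dv.
  have [w Gwv dw] := d_step v n dv; have [p [Gp lp sp]] := IHn w dw.
  by exists (rcons p v); rewrite rcons_path last_rcons size_rcons lp sp Gp.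
have := path_dist Gp; rewrite lp sz_p => -[le_d /dist_path[q [Gq lq sq]]].
have du: d u = 0 by apply/eqP; rewrite d0.
have bound r : path G u r -> d (last u r) <= size r.
  elim/last_ind: r => [|r x IHr]; first by rewrite /= du.
  rewrite rcons_path last_rcons size_rcons => /andP[/IHr le_r /d_edge le_x].
  exact: leq_trans le_x _.
by apply/eqP; rewrite eqn_leq le_d -sq -{1}lq bound.
Qed.

Hypothesis connG : connected G.

Lemma dist_connected u v :
  exists p, [/\ path G u p, last u p = v & size p = dist G u v].
Proof.
apply: dist_path; have /connectP[p Gp ->] := connG u v.
by have [] := path_dist Gp.
Qed.

Lemma dist_edge u v w : G v w -> dist G u w <= (dist G u v).+1.
Proof.
move=> Gvw; have [p [Gp lp <-]] := dist_connected u v.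
have [|+ _] := @path_dist u (rcons p w); first by rewrite rcons_path Gp lp.
by rewrite last_rcons size_rcons.
Qed.

(** The witness is the penultimate vertex of a shortest path. *)
Lemma dist_step u v n : dist G u v = n.+1 -> exists2 w, G w v & dist G u w = n.
Proof.
move=> duv; have [p [+ + +]] := dist_connected u v.
rewrite duv; case/lastP: p => [//|p x].
rewrite rcons_path last_rcons size_rcons => /andP[Gp Gx] xv [sp].
rewrite {}xv in Gx; exists (last u p) => //.
have [le_n _] := path_dist Gp; rewrite sp in le_n.
by apply/eqP; rewrite eqn_leq le_n -ltnS -duv dist_edge.
Qed.

Lemma dist1 u v : (dist G u v == 1) = G u v.
Proof.
apply/eqP/idP => [/dist_step[w Gwv /eqP]|/dist_adj//].
by rewrite dist0 => /eqP ->.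
Qed.

End Distance.

(** * Isomorphism, and resolving sets as coordinate systems *)

Lemma isomorphic_sym (V W : finType) (G : sgraph V) (H : sgraph W) :
  isomorphic G H -> isomorphic H G.
Proof.
by case=> f [g fK gK] fGH; exists g => [|x y]; [exists f | rewrite -fGH !gK].
Qed.

Lemma isomorphic_refl (V : finType) (G : sgraph V) : isomorphic G G.
Proof. by exists id => //; exists id. Qed.

Lemma dist_isomorphic (V W : finType) (G : sgraph V) (H : sgraph W)
    (g : W -> V) :
    connected G -> bijective g -> (forall x y, G (g x) (g y) = H x y) ->
  forall x y, dist H x y = dist G (g x) (g y).
Proof.
move=> connG [f gK fK] gHG x; apply: dist_unique => [y|y z|y n].
- by rewrite dist0 (can_eq gK).
- by rewrite -gHG; apply: dist_edge.
- case/(dist_step connG) => w Gwy dw; exists (f w); last by rewrite fK.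
  by rewrite -gHG fK.
Qed.

(** Here [g] labels the resolving set by ['I_k] and each other vertex by its own distance vector.
    Keeping [m] and [k] as free parameters avoids types that depend on [max_dist G W] and [#|W|]. *)
Definition coordinates (V : finType) (G : sgraph V) (m k : nat)
    (g : 'I_k + vec m k -> V) : Prop :=
  bijective g /\ forall i x, dist G (g (inl i)) (g (inr x)) = crd x i.

Lemma resolvableP (V : finType) (G : sgraph V) :
  completeness_resolvable G <->
  exists m k (g : 'I_k + vec m k -> V), [/\ 0 < m, 0 < k & coordinates G g].
Proof.
split=> [[W [W0 /properP[_ [u _ uW]] [Psi [PsiE [Phi PsiK PhiK]]]]]|].
  pose g (a : 'I_#|W| + vec (max_dist G W) #|W|) :=
    match a with inl i => enum_val i | inr x => val (Phi x) end.
  have k0: 0 < #|W| by rewrite card_gt0.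
  exists (max_dist G W), #|W|, g; split=> //.
    (* A coordinate of [Psi] at a vertex outside [W] is an element of ['I_m], so [m] is positive. *)
    exact: leq_ltn_trans (leq0n _) (ltn_ord (Psi (Sub u uW) (Ordinal k0))).
  split=> [|i x]; last by rewrite /= -PsiE PhiK.
  pose f v := if insub v is Some v' then inr (Psi v')
              else inl (enum_rank_in (enum_valP (Ordinal k0)) v).
  exists f => [[i|x]|v]; rewrite /f /=.
  - by rewrite insubN ?negbK ?enum_valP // enum_valK_in.
  - by rewrite valK PhiK.
  - case: insubP => [w _ wv|]; first by rewrite /= PsiK.
    by rewrite negbK => vW; rewrite /= enum_rankK_in.
case=> m [k [g [m0 k0 [g_bij gE]]]]; have g_inj := bij_inj g_bij.
pose W := [set g (inl i) | i : 'I_k].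
have cardW: #|W| = k by rewrite card_imset ?card_ord // => i j /g_inj[].
have inW i : g (inl i) \in W by apply: imset_f.
have ninW x : g (inr x) \notin W by apply/imsetP=> -[i _ /g_inj].
have notW u : u \notin W -> exists x, u = g (inr x).
  have [f fK gK] := g_bij; rewrite -[u]gK; case: (f u) => [i|x _].
    by rewrite inW.
  by exists x.
have maxW: max_dist G W = m.
  apply/eqP; rewrite eqn_leq; apply/andP; split.
    apply/bigmax_leqP=> _ /imsetP[i _ ->]; apply/bigmax_leqP=> u /notW[x ->].
    by rewrite gE /crd ltn_ord.
  have m1: m.-1 < m by rewrite prednK.
  (* The vector with all coordinates equal to [m] attains the maximal distance. *)
  pose x : vec m k := [ffun=> Ordinal m1]; pose i := Ordinal k0.
  apply: (bigmax_sup (g (inl i))) => //; apply: (bigmax_sup (g (inr x))) => //.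
  by rewrite gE /crd ffunE /= prednK.
exists W; split.
- by apply/set0Pn; exists (g (inl (Ordinal k0))).
- apply/properP; split; first exact: subsetT.
  exists (g (inr [ffun=> Ordinal m0])) => //; exact: ninW.
(* Since [crd] adds one to the stored ordinal, [Psi] must store the distance minus one. *)
have lt_dist (u : {u | u \notin W}) (i : 'I_#|W|) :
    (dist G (enum_val i) (val u)).-1 < max_dist G W.
  have /imsetP[j _ ->] := enum_valP i; have [x ->] := notW _ (valP u).
  by rewrite gE maxW /= ltn_ord.
pose Psi u : vec (max_dist G W) #|W| := [ffun i => Ordinal (lt_dist u i)].
exists Psi; split=> [u i|].
  rewrite /crd ffunE /= prednK // lt0n dist0.
  by apply/eqP => iu; have := valP u; rewrite /= -iu enum_valP.
apply: inj_card_bij => [u v /ffunP uv|].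
  apply: val_inj; have [[x ux] [y vy]] := (notW _ (valP u), notW _ (valP v)).
  rewrite ux vy; congr (g (inr _)); apply/ffunP=> i.
  have := uv (enum_rank_in (inW i) (g (inl i))).
  rewrite !ffunE => /(congr1 val); rewrite /= enum_rankK_in //.
  by rewrite ux vy !gE /= => /val_inj.
(* Injectivity suffices by counting: [g] forces [V] to have k + m^k elements, of which [W] takes
   k. *)
rewrite card_ffun !card_ord card_sig maxW cardW.
have := bij_eq_card g_bij; rewrite card_sum card_ffun !card_ord.
rewrite -(cardC (mem W)) cardW => /addnI ->.
by apply/eq_leq/eq_card=> u; rewrite !inE.
Qed.

Lemma resolvable_isomorphic (V W : finType) (G : sgraph V) (H : sgraph W) :
    connected G -> isomorphic G H ->
  completeness_resolvable H -> completeness_resolvable G.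
Proof.
move=> connG /isomorphic_sym[f f_bij fHG].
case/resolvableP=> m [k [g [m0 k0 [g_bij gE]]]].
apply/resolvableP; exists m, k, (f \o g); split=> //; split=> [|i x].
  exact: bij_comp.
by rewrite -gE (dist_isomorphic connG f_bij fHG).
Qed.

(** * Every graph in the first two classes is resolvable *)

Lemma resolvable_path n : 2 <= n -> completeness_resolvable (path_graph n).
Proof.
case: n => [//|n] n0; apply/resolvableP.
(* The resolving set is the end vertex 0, whose distance to a vertex is the number of that vertex;
   [lift ord0] supplies the shift by one built into [crd]. *)
pose g (a : 'I_1 + vec n 1) : 'I_n.+1 :=
  match a with inl _ => ord0 | inr x => lift ord0 (x ord0) end.
exists n, 1, g; split=> //; split=> [|i x].
  apply: inj_card_bij; last by rewrite card_sum card_ffun !card_ord expn1.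
  move=> [i|x] [j|y] //= => [_|/lift_inj xy]; first by rewrite !ord1.
  by congr inr; apply/ffunP=> i; rewrite ord1.
rewrite (@dist_unique _ _ _ (@nat_of_ord n.+1)).
- by rewrite ord1.
- by move=> v; rewrite eq_sym.
- by move=> v w /orP[]/eqP; lia.
- move=> v p vE; have lt_p: p < n.+1.
    by have := ltn_ord v; rewrite vE; apply: ltnW.
  by exists (Ordinal lt_p) => //=; rewrite /path_adj /= vE eqxx.
Qed.

Lemma resolvable_universal (V : finType) (G : sgraph V) :
  class_K G -> completeness_resolvable G.
Proof.
case=> V2 [u univ_u]; apply/resolvableP.
(* The resolving set is the complement of the universal vertex, which receives the only vector of
   [1]^k. *)
pose A := [set~ u]; have cardA: #|A|.+1 = #|V|.
  rewrite -(cardC (pred1 u)) card1 add1n; congr _.+1.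
  by apply: eq_card => v; rewrite !inE.
pose g (a : 'I_#|A| + vec 1 #|A|) : V :=
  match a with inl i => enum_val i | inr _ => u end.
have neq_u (i : 'I_#|A|) : enum_val i != u by have := enum_valP i; rewrite !inE.
exists 1, #|A|, g; split=> //; first by rewrite -ltnS cardA.
split=> [|i x].
  apply: inj_card_bij; last first.
    by rewrite card_sum card_ffun !card_ord exp1n addn1 cardA.
  move=> [i|x] [j|y] //=.
  - by move/enum_val_inj->.
  - by move/eqP; rewrite (negPf (neq_u i)).
  - by move/eqP; rewrite eq_sym (negPf (neq_u j)).
  - by move=> _; congr inr; apply/ffunP=> i; rewrite !ord1.
by rewrite dist_adj /crd ?ord1 //= adj_sym univ_u.
Qed.

(** * Coverings, and resolvability of the last two classes *)

Lemma mem_edges (V : finType) (F : sgraph V) x y :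
  ([set x; y] \in edges F) = F x y.
Proof.
apply/imsetP/idP => [[[a b]]|Fxy]; last by exists (x, y); rewrite ?inE.
rewrite inE /= => Fab /setP E.
have ab: a != b by apply: contraTneq Fab => ->; rewrite adj_irrefl.
(* Evaluating the equality of pairs at these four points leaves only the two orders of the pair. *)
have := (E x, E y, E a, E b); rewrite !inE !eqxx ?orbT /=.
case=> -[[]]; do 2 case/esym/orP=> /eqP->;
  rewrite ?eqxx //= ?(negPf ab) ?[b == a]eq_sym ?(negPf ab) //.
by rewrite adj_sym.
Qed.

Lemma coveringP (V : finType) (F : sgraph V) (S : {set V}) (E : {set {set V}}) :
  reflect (E \subset edges F /\
           forall x, x \in S -> exists2 y, F x y & [set x; y] \in E)
          (E \in coverings F S).
Proof.
rewrite inE; apply: (iffP andP) => -[sub_E covE]; split=> //.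
  move=> x xS; have /exists_inP[p pE xp] := forall_inP covE x xS.
  have /imsetP[[a b]] := subsetP sub_E p pE; rewrite inE /= => Fab pab.
  rewrite {}pab in pE xp; case/set2P: xp => ->; first by exists b.
  by exists a; rewrite 1?adj_sym // setUC.
apply/forall_inP=> x /covE[y _ xyE]; apply/exists_inP; exists [set x; y] => //.
exact: set21.
Qed.

Lemma span_edge (V : finType) (E : {set {set V}}) (F : sgraph V) x y :
  F x y -> [set x; y] \in E -> span E x y.
Proof.
move=> Fxy xyE; rewrite /= /span_adj xyE andbT.
by apply: contraTneq Fxy => ->; rewrite adj_irrefl.
Qed.

Lemma coordinates_id m k (H : sgraph ('I_k + vec m k)%type) :
  (forall i x, dist H (inl i) (inr x) = crd x i) ->
  coordinates H id.
Proof. by split=> //; exists id. Qed.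

Lemma resolvable_B k (W : finType) (H : sgraph W) :
  0 < k -> class_B k H -> completeness_resolvable H.
Proof.
move=> k0; case: W H / => H1 E covE; set H := circ _ _.
apply/resolvableP; exists 2, k, id; split=> //.
apply: coordinates_id => i.
(* The expected distance from [i]: nonadjacent labels are at distance 2 because the all-ones vector
   is adjacent to every label. *)
pose d (a : 'I_k + vec 2 k) := match a with
  | inl j => if i == j then 0 else if H1 i j then 1 else 2
  | inr x => crd x i end.
have crd_bd (x : vec 2 k) t : 0 < crd x t <= 2 by rewrite /crd ltn_ord.
suff dE a : dist H (inl i) a = d a by move=> x; rewrite dE.
apply: dist_unique a => [[j|x]|a b|[j|x] n] //=.
- have -> : (inl i == inl j :> 'I_k + vec 2 k) = (i == j) by [].
  by case: (i == j); case: (H1 i j).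
(* As [d] never exceeds 2, a jump by more than 1 could occur only along an edge leaving [inl i]. *)
- have d2 c : d c <= 2.
    case: c => [j|x] /=; last by case/andP: (crd_bd x i).
    by case: (i == j); case: (H1 i j).
  case: (posnP (d a)) => [|da _]; last exact: leq_trans (d2 b) _.
  case: a => [j|x] /=; last by [].
  case: eqP => [<- _|_]; last by case: ifP.
  case: b => [t|x] /=; last by move/eqP->.
  by case: eqP => // _ ->.
- case: eqP => // /eqP ij; case: ifP => [Hij|Hij] [<-].
    by exists (inl i) => //=; rewrite eqxx.
  by exists (inr [ffun=> ord0]) => //=; rewrite /crd ffunE.
- move=> xn; have := crd_bd x i; rewrite xn; case: n xn => [|[|//]] xi _.
    by exists (inl i); rewrite /= ?xi ?eqxx.
  have /coveringP[sub_E cov_i] := covE i.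
  (* Here coordinate [i] of [x] is 2. If [x] is 2 on the closed neighbourhood of [i], the covering
     supplies a vector neighbour with value 1 at [i]; otherwise a neighbour [j] of [i] where [x] has
     value 1 is one step closer. *)
  have [/cov_i[y Fxy xyE]|] :=
    boolP (x \in subcube 2 (closed_nbh H1 i) [:: 2]).
    have Sxy: span (\bigcup_(t < k) E t) x y.
      by apply: span_edge Fxy _; apply/bigcupP; exists i.
    exists (inr y).
      by change (span (\bigcup_(t < k) E t) y x); rewrite adj_sym.
    move: Fxy; rewrite /= /bipartite_adj => /andP[_].
    case/orP=> /and3P[]; rewrite !inE => /forall_inP X /forall_inP Y _.
      by have := X i (set11 i); rewrite xi.
    by have := X i (set11 i); rewrite inE => /eqP.
  rewrite inE negb_forall => /existsP[j].
  rewrite negb_imply !inE => /andP[/orP[/eqP->|Hij] xj].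
    by rewrite xi in xj.
  have xj1: crd x j == 1 by have := crd_bd x j; lia.
  exists (inl j) => //=; rewrite Hij; case: eqP => // ij.
  by rewrite ij adj_irrefl in Hij.
Qed.

Lemma resolvable_C k (W : finType) (H : sgraph W) :
  0 < k -> class_C k H -> completeness_resolvable H.
Proof.
move=> k0; case: W H / => E F covE covF; set H := circ _ _.
set S := span _ in H *.
apply/resolvableP; exists 3, k, id; split=> //.
have S_edge x y : S x y -> exists i, graph_C i x y || graph_D i x y.
  case/andP=> _ /bigcupP[i _ /setUP[] xyE]; exists i; rewrite -!mem_edges.
    by have /coveringP[/subsetP->] := covE i.
  by have /coveringP[/subsetP->] := covF i; rewrite ?orbT.
(* An edge from [E j] or [F j] changes coordinate [j] by exactly 1, and the others by at most 1
   through [near_off]. *)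
have near i (x y : vec 3 k) : S x y -> crd y i <= (crd x i).+1.
  case/S_edge=> j; rewrite /= /bipartite_adj !inE.
  have [{j}<-|ij] := eqVneq i j; last first.
    have near_ij (u v : vec 3 k) : near_off j u v ->
        (crd u i <= (crd v i).+1) && (crd v i <= (crd u i).+1).
      by move/forall_inP/(_ i ij).
    by case/orP=> /andP[_ /orP[]] /and3P[_ _ /near_ij/andP[]].
  by case/orP=> /andP[_ /orP[]] /and3P[/forall_inP X /forall_inP Y _];
    have := X i (set11 i); have := Y i (set11 i); rewrite !inE => /eqP-> /eqP->.
apply: coordinates_id => i.
pose d (a : 'I_k + vec 3 k) := match a with
  | inl j => if i == j then 0 else 2
  | inr x => crd x i end.
have crd_bd (x : vec 3 k) t : 0 < crd x t <= 3 by rewrite /crd ltn_ord.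
suff dE a : dist H (inl i) a = d a by move=> x; rewrite dE.
apply: dist_unique a => [[j|x]|[j|x] [t|y]|[j|x] n] //=.
- have -> : (inl i == inl j :> 'I_k + vec 3 k) = (i == j) by [].
  by case: (i == j).
- by have [<- /eqP->|_ _] := eqVneq i j; last by case/andP: (crd_bd y i).
- by have [//|_ _] := eqVneq i t; case/andP: (crd_bd x i).
- exact: near.
- case: eqP => // ij [<-].
  by exists (inr [ffun=> ord0]) => //=; rewrite /crd ffunE.
- move=> xn; have := crd_bd x i; rewrite xn; case: n xn => [|[|[|//]]] xi _.
  + by exists (inl i); rewrite /= ?xi ?eqxx.
  + have /coveringP[_ /(_ x)[|y Fxy xyE]] := covE i.
      by rewrite inE; apply/forall_inP=> j; rewrite !inE => /eqP->; rewrite xi.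
    have Sxy: S x y.
      by apply: span_edge Fxy _; apply/bigcupP; exists i; rewrite // inE xyE.
    exists (inr y); first by change (S y x); rewrite adj_sym.
    move: Fxy; rewrite /= /bipartite_adj => /andP[_].
    case/orP=> /and3P[]; rewrite !inE => /forall_inP X /forall_inP Y _.
      by have := X i (set11 i); rewrite xi.
    by have := X i (set11 i); rewrite inE => /eqP.
  + have [xS|] := boolP (x \in set_S i).
      have /coveringP[_ /(_ x xS)[y Fxy xyE]] := covF i.
      have Sxy: S x y.
        apply: span_edge Fxy _; apply/bigcupP; exists i => //.
        by rewrite inE xyE orbT.
      exists (inr y); first by change (S y x); rewrite adj_sym.
      move: Fxy; rewrite /= /bipartite_adj => /andP[_].
      case/orP=> /and3P[]; rewrite !inE => /forall_inP X /forall_inP Y _.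
        by have := X i (set11 i); rewrite xi.
      by have := X i (set11 i); rewrite inE => /eqP.
    rewrite !inE negb_and => /orP[]; last first.
      by case/forall_inP=> j; rewrite !inE => /eqP->; rewrite xi.
    (* A vector with value 3 at [i] outside [set_S i] has value 1 at some [j]; the label [j] is then
       a neighbour at distance 2 from [i]. *)
    rewrite negb_forall => /existsP[j]; rewrite inE /= !inE => xj.
    have xj1: crd x j == 1 by have := crd_bd x j; lia.
    exists (inl j) => //=; case: eqP => // ij.
    by rewrite -ij xi in xj1.
Qed.

(** * Constraints that coordinates impose on a connected graph *)

Section Classification.
Variables (V : finType) (G : sgraph V).
Hypothesis connG : connected G.

Lemma universal_coordinates k (g : 'I_k + vec 1 k -> V) :
  coordinates G g -> exists u, universal G u.
Proof.
case=> [[f fK gK] gE]; pose x0 : vec 1 k := [ffun=> ord0].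
have vec1 (x : vec 1 k) : x = x0 by apply/ffunP=> i; rewrite !ord1.
exists (g (inr x0)) => v; rewrite -[v]gK; case: (f v) => [i _|x].
  by rewrite adj_sym -dist1 // gE /crd ord1.
by rewrite (vec1 x) eqxx.
Qed.

Lemma path_coordinates m (g : 'I_1 + vec m 1 -> V) :
  coordinates G g -> isomorphic G (path_graph m.+1).
Proof.
case=> g_bij gE; have [f fK gK] := g_bij; pose w := g (inl ord0).
have dw0 : dist G w w = 0 by apply/eqP; rewrite dist0.
have dwE a : dist G w (g a) = if a is inr x then crd x ord0 else 0.
  by case: a => [i|x]; rewrite ?gE // ord1.
have lt_d v : dist G w v < m.+1.
  by rewrite -[v]gK dwE; case: (f v) => [i|x] //; rewrite ltnS /crd ltn_ord.
pose h v := Ordinal (lt_d v).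
have h_inj : injective h.
  move=> u v /(congr1 val) /=; rewrite -[u]gK -[v]gK !dwE.
  case: (f u) (f v) => [i|x] [j|y] //; first by rewrite !ord1.
  by case=> /val_inj xy; congr (g (inr _)); apply/ffunP=> i; rewrite ord1.
exists h => [|x y].
  apply: inj_card_bij => //.
  by rewrite -(bij_eq_card g_bij) card_sum card_ffun !card_ord expn1.
(* Distances from [w] separate vertices, so the neighbour of [v] one step closer to [w] can only be
   [u]. *)
have step u v : (dist G w u).+1 = dist G w v -> G u v.
  move/esym/(dist_step connG) => [z Gzv zu]; rewrite -(h_inj z u) //.
  exact: val_inj.
apply/orP/idP => [[]/eqP/step//|Gxy]; first by rewrite adj_sym.
have := dist_edge connG w Gxy.
have := dist_edge connG w (etrans (adj_sym G y x) Gxy).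
have : dist G w x != dist G w y.
  apply: contraTneq Gxy => dxy; rewrite (h_inj x y) ?adj_irrefl //.
  exact: val_inj.
rewrite /=; move: (dist G w x) (dist G w y) => a b ab ba ba'.
by have [?|?] : a.+1 = b \/ b.+1 = a by [lia]; [left|right]; apply/eqP.
Qed.

Variables (m k : nat) (g : 'I_k + vec m k -> V).
Hypothesis gG : coordinates G g.

Definition pull_adj (T : finType) (h : T -> V) : rel T :=
  fun x y => G (h x) (h y).

Lemma pull_adj_sym (T : finType) (h : T -> V) : symmetric (pull_adj h).
Proof. by move=> x y; apply: adj_sym. Qed.

Lemma pull_adj_irrefl (T : finType) (h : T -> V) : irreflexive (pull_adj h).
Proof. by move=> x; apply: adj_irrefl. Qed.

Definition pull (T : finType) (h : T -> V) :=
  SGraph (pull_adj_sym h) (pull_adj_irrefl h).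

Lemma coord_adj i x : G (g (inl i)) (g (inr x)) = (crd x i == 1).
Proof. by rewrite -dist1 // gG.2. Qed.

(** The coordinates already determine the edges between labels and vectors, so only edges within
    each side need comparison. *)
Lemma coord_circ (H1 : sgraph 'I_k) (E : {set {set vec m k}}) :
    (forall i j, H1 i j = G (g (inl i)) (g (inl j))) ->
    (forall x y, span E x y = G (g (inr x)) (g (inr y))) ->
  isomorphic G (circ H1 (span E)).
Proof.
move=> H1E spE; apply: isomorphic_sym; exists g; first exact: gG.1.
move=> [i|x] [j|y]; rewrite ?coord_adj //=; last exact/esym/spE.
by rewrite adj_sym coord_adj.
Qed.

Lemma coord_edge x y i : G (g (inr x)) (g (inr y)) -> crd y i <= (crd x i).+1.
Proof. by rewrite -!gG.2; apply: dist_edge. Qed.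

Hypothesis m1 : 0 < m.

Lemma coord_dist_le2 i j : dist G (g (inl i)) (g (inl j)) <= 2.
Proof.
pose x : vec m k := [ffun=> Ordinal m1].
have Gxj: G (g (inr x)) (g (inl j)) by rewrite adj_sym coord_adj /crd ffunE.
by have := dist_edge connG (g (inl i)) Gxj; rewrite gG.2 {1}/crd ffunE.
Qed.

Lemma coord_dist_ge i j : i != j -> m <= (dist G (g (inl i)) (g (inl j))).+1.
Proof.
move=> ij; have m1': m.-1 < m by rewrite prednK.
pose x : vec m k := [ffun t => if t == j then Ordinal m1 else Ordinal m1'].
have Gjx: G (g (inl j)) (g (inr x)) by rewrite coord_adj /crd ffunE eqxx.
have := dist_edge connG (g (inl i)) Gjx.
by rewrite gG.2 {1}/crd ffunE (negPf ij) /= prednK.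
Qed.

End Classification.

(** * Recovering the covering data for m = 2 and m = 3 *)

Lemma crd_set1 m k (x : vec m k) i c :
  crd x i = c -> [forall t in [set i], crd x t \in [:: c]].
Proof. by move=> <-; apply/forall_inP=> t /set1P->; rewrite inE. Qed.

Lemma vec_neq m k (x y : vec m k) : x != y -> exists i, x i != y i.
Proof.
move=> xy; apply/existsP; apply: contraNT xy => /existsPn xy.
by apply/eqP/ffunP=> i; have /negPn/eqP := xy i.
Qed.

Lemma classify_B (V : finType) (G : sgraph V) k (g : 'I_k + vec 2 k -> V) :
    connected G -> coordinates G g ->
  exists (W : finType) (H : sgraph W), class_B k H /\ isomorphic G H.
Proof.
move=> connG gG; pose H1 := pull G (g \o inl); pose H2 := pull G (g \o inr).
(* Each [E i] takes all edges between vectors that differ at [i]; one edge may lie in several of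
   these sets. *)
pose E i := edges H2 :&: edges (graph_B i).
exists ('I_k + vec 2 k)%type, (circ H1 (span (\bigcup_(i < k) E i))); split.
  constructor=> i; apply/coveringP; split; first exact: subsetIr.
  move=> x; rewrite inE => /forall_inP x2.
  have xi: crd x i = 2 by have := x2 i; rewrite !inE eqxx => /(_ isT)/eqP.
  have := gG.2 i x; rewrite xi => /(dist_step connG)[v Gvx dv].
  have [f fK gK] := gG.1; rewrite -[v]gK in Gvx dv.
  (* The neighbour of [x] closer to [i] cannot be a label [j]: adjacency to [i] gives [x] the value
     2 at [j], and adjacency to [x] gives the value 1. *)
  case: (f v) Gvx dv => [j|y] Gvx /eqP; rewrite ?dist1 // => Gij.
    have := x2 j; rewrite !inE [H1 _ _]Gij orbT => /(_ isT)/eqP.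
    by move: Gvx; rewrite (coord_adj connG gG) => /eqP->.
  rewrite (coord_adj connG gG) in Gij.
  have Fxy: graph_B i x y.
    rewrite /= /bipartite_adj; apply/andP; split.
      by apply: contraTneq Gij => <-; rewrite xi.
    apply/orP; right; rewrite !inE andbT; apply/andP.
    by split; apply/forall_inP=> t /set1P->; rewrite inE ?xi.
  by exists y; rewrite // inE !mem_edges Fxy andbT /= /pull_adj adj_sym.
apply: (coord_circ connG gG) => // x y; rewrite /= /span_adj.
apply/andP/idP => [[_ /bigcupP[i _ /setIP[]]]|Gxy]; first by rewrite mem_edges.
have xy: x != y by apply: contraTneq Gxy => ->; rewrite adj_irrefl.
split=> //; have [i xyi] := vec_neq xy.
apply/bigcupP; exists i => //; rewrite inE !mem_edges; apply/andP; split=> //.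
rewrite /= /bipartite_adj xy !inE !andbT.
have: (crd x i = 1 /\ crd y i = 2) \/ (crd x i = 2 /\ crd y i = 1).
  have := ltn_ord (x i); have := ltn_ord (y i).
  have : x i != y i :> nat by []. rewrite /crd; lia.
by case=> -[/crd_set1-> /crd_set1->]; rewrite ?orbT.
Qed.

Lemma classify_C (V : finType) (G : sgraph V) k (g : 'I_k + vec 3 k -> V) :
    connected G -> coordinates G g ->
  exists (W : finType) (H : sgraph W), class_C k H /\ isomorphic G H.
Proof.
move=> connG gG; pose H2 := pull G (g \o inr).
have edgeless_W i j : G (g (inl i)) (g (inl j)) = false.
  have [->|ij] := eqVneq i j; first by rewrite adj_irrefl.
  apply/negP => /dist_adj d1.
  by have := coord_dist_ge connG gG isT ij; rewrite d1.
have near x y i : H2 x y -> near_off i x y.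
  move=> Gxy; apply/forall_inP=> t _.
  rewrite (coord_edge connG gG _ Gxy) andbT (coord_edge connG gG) //.
  by rewrite adj_sym.
(* The neighbour closer to [i] is a vector: for n = 1 a label would be adjacent to [i], against
   independence, and without coordinates equal to 1 [x] has no neighbour among the labels. *)
have nbr x i n : crd x i = n.+1 -> (n == 1) || [forall j, crd x j != 1] ->
    0 < n -> exists2 y, H2 y x & crd y i = n.
  have := gG.2 i x => + xi; rewrite xi => /(dist_step connG)[v Gvx dv] n1 n0.
  have [f fK gK] := gG.1; rewrite -[v]gK in Gvx dv.
  case: (f v) Gvx dv => [j|y] Gvx dv; last by exists y; rewrite // -(gG.2 i).
  case/orP: n1 => [n1|/forallP/(_ j)]; last first.
    by rewrite -(coord_adj connG gG) Gvx.
  by move: dv n1 => <-; rewrite dist1 // edgeless_W.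
pose E i := edges H2 :&: edges (graph_C i).
pose F i := edges H2 :&: edges (graph_D i).
exists ('I_k + vec 3 k)%type.
exists (circ (edgeless 'I_k) (span (\bigcup_(i < k) (E i :|: F i)))); split.
  constructor=> i; apply/coveringP; split; try exact: subsetIr.
  - move=> x; rewrite inE => /forall_inP/(_ i (set11 i)).
    rewrite inE => /eqP xi.
    have [//|//|y Gyx yi] := nbr x i 1 xi.
    have Gxy : H2 x y by rewrite adj_sym.
    have Fxy: graph_C i x y.
      rewrite /= /bipartite_adj !inE (crd_set1 xi) (crd_set1 yi) !near //
        orbT andbT.
      by apply: contraPneq xi => ->; rewrite yi.
    by exists y; rewrite // inE !mem_edges Fxy Gxy.
  - move=> x; rewrite !inE => /andP[/forall_inP x23].
    move/forall_inP/(_ i (set11 i)); rewrite inE => /eqP xi.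
    have [|//|y Gyx yi] := nbr x i 2 xi.
      apply/forallP=> j; have := x23 j (in_setT j).
      by rewrite !inE => /orP[]/eqP->.
    have Gxy : H2 x y by rewrite adj_sym.
    have Fxy: graph_D i x y.
      rewrite /= /bipartite_adj !inE (crd_set1 xi) (crd_set1 yi) !near //
        orbT andbT.
      by apply: contraPneq xi => ->; rewrite yi.
    by exists y; rewrite // inE !mem_edges Fxy Gxy.
apply: (coord_circ connG gG) => // x y; rewrite /= /span_adj.
apply/andP/idP => [[_ /bigcupP[i _ /setUP[]/setIP[]]]|Gxy];
  rewrite ?mem_edges //.
have xy: x != y by apply: contraTneq Gxy => ->; rewrite adj_irrefl.
split=> //; have [i xyi] := vec_neq xy.
have Gyx : H2 y x by rewrite adj_sym.
apply/bigcupP; exists i => //; rewrite !inE !mem_edges [H2 x y]Gxy /=.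
rewrite /bipartite_adj xy !inE !near //.
have := coord_edge connG gG i Gxy; have := coord_edge connG gG i Gyx.
have := ltn_ord (x i); have := ltn_ord (y i); have: x i != y i :> nat by [].
move=> neq lt_y lt_x le_x le_y.
(* The values at [i] differ by exactly 1, so the edge belongs to [graph_C i] or [graph_D i]. *)
have: (crd x i = 1 /\ crd y i = 2 \/ crd x i = 2 /\ crd y i = 1) \/
      (crd x i = 2 /\ crd y i = 3 \/ crd x i = 3 /\ crd y i = 2).
  by move: neq lt_x lt_y le_x le_y; rewrite /crd; lia.
by case=> -[] [/crd_set1-> /crd_set1->]; rewrite ?orbT.
Qed.

Theorem theorem1p1 (V : finType) (G : sgraph V)
    (hV : 2 <= #|V|) (hG : connected G) :
  completeness_resolvable G <->
  exists (W : finType) (H : sgraph W),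
    [\/ class_P H, class_K H, exists2 k, 2 <= k & class_B k H
      | exists2 k, 2 <= k & class_C k H] /\
    isomorphic G H.
Proof.
split; last first.
  case=> W [H [H_class GH]]; apply: resolvable_isomorphic GH _ => //.
  case: H_class => [[n]|/resolvable_universal//|[k /ltnW k0]|[k /ltnW k0]].
  - exact: resolvable_path.
  - exact: resolvable_B.
  - exact: resolvable_C.
case/resolvableP=> m [k [g [m0 k0 gG]]].
have [m1|m1] := leqP m 1.
  have mE: m = 1 by apply/eqP; rewrite eqn_leq m1.
  subst m; exists V, G; split; last exact: isomorphic_refl.
  by constructor 2; split=> //; apply: universal_coordinates gG.
have [k1|k1] := leqP k 1.
  have kE: k = 1 by apply/eqP; rewrite eqn_leq k1.
  subst k; exists 'I_m.+1, (path_graph m.+1); split.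
    by constructor 1; constructor.
  exact: path_coordinates gG.
have m3: m <= 3.
  have ij : Ordinal k0 != Ordinal k1 by [].
  apply: leq_trans (coord_dist_ge hG gG m0 ij) _; rewrite ltnS.
  exact: (coord_dist_le2 hG gG m0).
have [m2|m2] := leqP m 2.
  have mE: m = 2 by apply/eqP; rewrite eqn_leq m2.
  subst m; have [W [H [BH GH]]] := classify_B hG gG.
  by exists W, H; split=> //; constructor 3; exists k.
have mE: m = 3 by apply/eqP; rewrite eqn_leq m3.
subst m; have [W [H [CH GH]]] := classify_C hG gG.
by exists W, H; split=> //; constructor 4; exists k.
Qed.
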